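(* The category $\mathbf{WSS}_1$ of strongly $T_1$ weakly small generalized topological spaces and strictly continuous mappings is finitely complete (it has all finite limits).
   Context: For a family of sets $\mathcal U$ and a set $V$, $V\underline{\cap}\,\mathcal U=\{V\cap U: U\in\mathcal U\}$. For a set $\Phi$ of families of sets, $\underline{\bigcup}\Phi=\{\bigcup\mathcal U:\mathcal U\in\Phi\}$. $\mathcal U\preceq\mathcal V$ means that $\bigcup\mathcal U=\bigcup\mathcal V$ and every member of $\mathcal U$ is contained in some member of $\mathcal V$. A generalized topological space (gts) is a triple $(M,Op_M,Cov_M)$, where $M$ is a set, $Op_M\subseteq\mathcal P(M)$ (the open sets) and $Cov_M\subseteq\mathcal P(Op_M)$ (the admissible families), such that: (finiteness) if $\mathcal U$ is a finite subfamily of $Op_M$, then $\bigcup\mathcal U,\bigcap\mathcal U\in Op_M$ (with $\bigcup\emptyset=\emptyset$, $\bigcap\emptyset=M$) and $\mathcal U\in Cov_M$; (stability) if $V\in Op_M$ and $\mathcal U\in Cov_M$, then $V\underline{\cap}\,\mathcal U\in Cov_M$; (transitivity) if $\Phi\subseteq Cov_M$ and $\underline{\bigcup}\Phi\in Cov_M$, then $\bigcup\Phi\in Cov_M$; (saturation) if $\mathcal U\in Cov_M$, $\mathcal V\subseteq Op_M$ and $\mathcal U\preceq\mathcal V$, then $\mathcal V\in Cov_M$; (regularity) if $W\subseteq M$, $\mathcal U\in Cov_M$ and $W\underline{\cap}\,\mathcal U\subseteq Op_M$, then $W\cap\bigcup\mathcal U\in Op_M$. A set is closed if its complement is open. A gts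 is strongly $T_1$ if every singleton is closed. A mapping between gtses is strictly continuous if the preimage $\{f^{-1}(U):U\in\mathcal U\}$ of every admissible family $\mathcal U$ is an admissible family. $\mathbf{GTS}$ is the category of gtses and strictly continuous mappings. A subset $K$ of a gts $X$ is small if for every admissible family $\mathcal U$, the set $K\cap\bigcup\mathcal U$ is covered by finitely many members of $\mathcal U$. A small subset $K$ of $X$ is regarded as a gts (a subspace of $X$), whose open sets are the traces $U\cap K$ of open sets of $X$ and whose admissible families are the traces $K\underline{\cap}\,\mathcal U$ of admissible families of $X$ (these are exactly the families of open subsets of $K$ having a finite subfamily with the same union). A gts $X$ is weakly small if it has an exhaustion, i.e. a family $(X_\alpha)_{\alpha\in A}$ of closed small subspaces indexed by a partially ordered set $A$ such that: (W1) $X$ is the union of all $X_\alpha$ as sets; (W2) if $\alpha\le\beta$ then $X_\alpha$ is a (closed, small) subspace of $X_\beta$; (W3) for each $\alpha\in A$ there are only finitely many $\beta\in A$ with $\beta<\alpha$; (W4) for all $\alpha,\beta\in A$ there is $\gamma\in A$ with $X_\alpha\cap X_\beta=X_\gamma$; (W5) for all $\alpha,\beta\in A$ there is $\gamma\in A$ with $\gamma\ge\alpha$ and $\gamma\ge\beta$; (W6) the gts $X$ is the inductive limit of the directed family $(X_\alpha)_{\alpha\in A}$, which means: a subset $U\subseteq X$ is open iff $X_\alpha\cap U$ is open in $X_\alpha$ for every $\alpha$, and a family $\mathcal U$ of open sets is admissible iff $X_\alpha\underline{\cap}\,\mathcal U$ is admissible (equivalently, has a finite subfamily with the same union) in $X_\alpha$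 for every $\alpha$. $\mathbf{WSS}_1$ is the full subcategory of $\mathbf{GTS}$ whose objects are the weakly small gtses that are strongly $T_1$.
   Formalization: (W4) is strengthened: the index γ with X_α ∩ X_β = X_γ is also required to satisfy γ ≤ α and γ ≤ β; with (W4) as written, the order need not reflect inclusion, (W3) becomes void, and some equalizers fail to exist. *)

(* Defs.v *)
From mathcomp Require Import all_boot.
From mathcomp Require Import boolp classical_sets functions cardinality.

Set Implicit Arguments.
Unset Strict Implicit.
Unset Printing Implicit Defensive.

Local Open Scope classical_set_scope.

Definition trace (M : Type) (K : set M) (U : set (set M)) : set (set M) :=
  [set K `&` V | V in U].

Definition bigU (M : Type) (U : set (set M)) : set M := \bigcup_(V in U) V.

(* \bigcap over the empty family is setT. *)
Definition bigI (M : Type) (U : set (set M)) : set M := \bigcap_(V in U) V.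

Definition refines (M : Type) (U V : set (set M)) : Prop :=
  bigU U = bigU V /\ (forall A, U A -> exists2 B, V B & A `<=` B).

(** ** Generalized topological spaces *)

Record gts : Type := Gts {
  gpt :> Type;
  gopen : set (set gpt);
  gadm : set (set (set gpt));
  gadm_open : forall U, gadm U -> U `<=` gopen;
  gts_finiteness : forall U, finite_set U -> U `<=` gopen ->
    [/\ gopen (bigU U), gopen (bigI U) & gadm U];
  gts_stability : forall V U, gopen V -> gadm U -> gadm (trace V U);
  gts_transitivity : forall Phi : set (set (set gpt)),
    Phi `<=` gadm -> gadm [set bigU U | U in Phi] ->
    gadm (\bigcup_(U in Phi) U);
  gts_saturation : forall U V,
    gadm U -> V `<=` gopen -> refines U V -> gadm V;
  gts_regularity : forall W U,
    gadm U -> trace W U `<=` gopen -> gopen (W `&` bigU U)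
}.

Definition gclosed (X : gts) (C : set X) : Prop := gopen (~` C).

Definition strongly_T1 (X : gts) : Prop := forall x : X, gclosed [set x].

Definition strictly_continuous (X Y : gts) (f : X -> Y) : Prop :=
  forall U : set (set Y), gadm U -> gadm [set f @^-1` V | V in U].

(** ** Small subspaces *)

Definition finitely_covered (M : Type) (A : set M) (U : set (set M)) : Prop :=
  exists V : set (set M), [/\ V `<=` U, finite_set V & A `<=` bigU V].

Definition small (X : gts) (K : set X) : Prop :=
  forall U, gadm U -> finitely_covered (K `&` bigU U) U.

(* The gts structure carried by a small subset [K] of [X]; open sets and
   families of [K] are kept as sets, resp. families of sets, of points of [X]. *)
Definition sub_open (X : gts) (K : set X) : set (set X) := trace K (@gopen X).

Definition sub_adm (X : gts) (K : set X) : set (set (set X)) :=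
  [set trace K U | U in @gadm X].

(* [K] is a closed small subspace of the gts [L], where [K] and [L] are small
   subsets of [X] with the structures [sub_open] and [sub_adm]. *)
Record closed_small_subspace (X : gts) (K L : set X) : Prop := {
  css_subset : K `<=` L;
  css_closed : sub_open L (L `\` K);
  css_small : forall U, sub_adm L U -> finitely_covered (K `&` bigU U) U;
  css_open : sub_open K = trace K (sub_open L);
  css_adm : sub_adm K = [set trace K U | U in sub_adm L]
}.

(** ** Weakly small spaces *)

Record partial_order (A : Type) (le : A -> A -> Prop) : Prop := {
  po_refl : forall a, le a a;
  po_anti : forall a b, le a b -> le b a -> a = b;
  po_trans : forall a b c, le a b -> le b c -> le a c
}.

(* In (W4) the index of the intersection is taken below both indices, i.e. the
   order of [A] sees [E c] as a subspace of [E a] and of [E b]; hence, with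
   (W3), every point lies in a member of least index. If the index [c] could be
   unrelated to [a] and [b], (W3) would be void: finite sets of indices, ordered
   by inclusion, could replace the indices of any directed family stable under
   finite intersections. *)
Record exhaustion (X : gts) (A : Type) (le : A -> A -> Prop) (E : A -> set X)
    : Prop := {
  exh_order : partial_order le;
  exh_closed : forall a, gclosed (E a);
  exh_small : forall a, small (E a);
  exh_W1 : \bigcup_a E a = [set: X];
  exh_W2 : forall a b, le a b -> closed_small_subspace (E a) (E b);
  exh_W3 : forall a, finite_set [set b | le b a /\ b <> a];
  exh_W4 : forall a b, exists c, [/\ le c a, le c b & E a `&` E b = E c];
  exh_W5 : forall a b, exists c, le a c /\ le b c;
  exh_W6_open : forall U : set X,
    gopen U <-> forall a, sub_open (E a) (E a `&` U);
  exh_W6_adm : forall U : set (set X), U `<=` @gopen X ->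
    (gadm U <-> forall a, sub_adm (E a) (trace (E a) U))
}.

Definition weakly_small (X : gts) : Prop :=
  exists (A : Type) (le : A -> A -> Prop) (E : A -> set X), exhaustion le E.

(** ** Categories and finite limits *)

Record category : Type := Category {
  obj :> Type;
  hom : obj -> obj -> Type;
  idm : forall a, hom a a;
  cmp : forall a b c, hom b c -> hom a b -> hom a c;
  cmp_idl : forall a b (f : hom a b), cmp (idm b) f = f;
  cmp_idr : forall a b (f : hom a b), cmp f (idm a) = f;
  cmp_assoc : forall a b c d (f : hom a b) (g : hom b c) (h : hom c d),
    cmp h (cmp g f) = cmp (cmp h g) f
}.

Arguments hom {_} _ _.
Arguments idm {_} a.
Arguments cmp {_ _ _ _} _ _.

Record functor (J C : category) : Type := Functor {
  fobj :> J -> C;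
  fhom : forall a b, hom a b -> hom (fobj a) (fobj b);
  fhom_id : forall a, fhom (idm a) = idm (fobj a);
  fhom_cmp : forall a b c (f : hom a b) (g : hom b c),
    fhom (cmp g f) = cmp (fhom g) (fhom f)
}.

Arguments fhom {_ _} _ {_ _} _.

Record cone (J C : category) (F : functor J C) : Type := Cone {
  apex : C;
  leg : forall j, hom apex (F j);
  leg_nat : forall i j (u : hom i j), cmp (fhom F u) (leg i) = leg j
}.

Definition is_limit (J C : category) (F : functor J C) (L : cone F) : Prop :=
  forall K : cone F,
    exists! h : hom (apex K) (apex L), forall j, cmp (leg L j) h = leg K j.

Definition finite_category (J : category) : Prop :=
  finite_set [set: obj J] /\
  forall a b : J, finite_set [set: hom a b].

Definition finitely_complete (C : category) : Prop :=
  forall J : category, finite_category J ->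
  forall F : functor J C, exists L : cone F, is_limit L.

Program Definition full_subcategory (C : category) (P : C -> Prop) : category :=
  @Category {X : C | P X} (fun X Y => hom (sval X) (sval Y))
    (fun X => idm (sval X)) (fun _ _ _ g f => cmp g f) _ _ _.
Next Obligation. by move=> *; exact: cmp_idl. Qed.
Next Obligation. by move=> *; exact: cmp_idr. Qed.
Next Obligation. by move=> *; exact: cmp_assoc. Qed.

(** ** The categories GTS and WSS1 *)

Definition gts_hom (X Y : gts) : Type := {f : X -> Y | strictly_continuous f}.

Lemma strictly_continuous_id (X : gts) : strictly_continuous (fun x : X => x).
Proof. by move=> U; rewrite (_ : [set _ | _ in _] = U) // image_id. Qed.

Lemma strictly_continuous_comp (X Y Z : gts) (g : Y -> Z) (f : X -> Y) :
  strictly_continuous g -> strictly_continuous f ->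
  strictly_continuous (fun x => g (f x)).
Proof.
move=> hg hf U /hg /hf; congr gadm; rewrite image_comp.
by apply: eq_imagel => V _.
Qed.

Definition gts_id (X : gts) : gts_hom X X :=
  exist _ (fun x => x) (@strictly_continuous_id X).

Definition gts_comp (X Y Z : gts) (g : gts_hom Y Z) (f : gts_hom X Y) :
  gts_hom X Z :=
  exist _ (fun x => sval g (sval f x))
    (strictly_continuous_comp (svalP g) (svalP f)).

Lemma gts_hom_eq (X Y : gts) (f g : gts_hom X Y) : sval f = sval g -> f = g.
Proof. by case: f g => [f hf] [g hg] /= fg; exact: eq_exist. Qed.

Program Definition GTS : category :=
  @Category gts gts_hom gts_id gts_comp _ _ _.
Next Obligation. by move=> *; exact: gts_hom_eq. Qed.
Next Obligation. by move=> *; exact: gts_hom_eq. Qed.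
Next Obligation. by move=> *; exact: gts_hom_eq. Qed.

Definition WSS1 : category :=
  full_subcategory (C := GTS) (fun X : gts => weakly_small X /\ strongly_T1 X).

(* Main.v *)
From mathcomp Require Import all_boot.
From mathcomp Require Import boolp classical_sets functions cardinality.
Require Import Defs.

(** A finite diagram in [WSS1] has a limit because its set-theoretic limit, a
set of tuples in a finite product, can be exhausted by boxes.

If the spaces [X i] have exhaustions [E i] indexed by [A i], the boxes
[E a = \prod_i E i (a i)], [a] in the product of the finitely many posets
[A i], satisfy the combinatorial axioms (W1)-(W5), and so do their traces on
any subset [T] of the product.  Let [L] be the lattice of subsets of [T]
generated by the preimages of open sets under the projections, and glue: a set
is open when it agrees on each [E a] with a member of [L], and a family of open
sets is admissible when on each [E a] finitely many of its members have the
same union ([ind_gts]).  This is a gts, exhausted by the [E a]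
([ind_exhaustion]), and the projections are strictly continuous because every
[E i (a i)] is small.  Here [T] is an arbitrary subset of the product: strongly
T1 spaces need not be Hausdorff, so that equalizers need not be closed.

The point is the universal property.  Let [h : Y -> T] have strictly continuous
components, [Y] being weakly small.  To check [h] on a member [K] of an
exhaustion of [Y] one needs [h @` K] to lie in one box, since the structure of
[T] is known on boxes only.  The components map [K] to small sets
([small_image]), so everything rests on [small_sub_exhaustion]: in a strongly
T1 space with an exhaustion, a nonempty small set lies in a member of the
exhaustion.  There (W3), (W4) and T1 are used: a small set that lies in no
member would contain an infinite set having a finite trace on every member;
all subsets of such a set are closed, and their complements provide an
admissible family that covers it and has no finite subcover. *)

Set Implicit Arguments.
Unset Strict Implicit.
Unset Printing Implicit Defensive.

Local Open Scope classical_set_scope.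

(** * Finite families of sets *)

Lemma finite_set_induct (T : Type) (P : set T -> Prop) :
  P set0 -> (forall x A, P A -> P (x |` A)) ->
  forall A, finite_set A -> P A.
Proof.
move=> P0 PU A /(@finite_seqP {classic T})[s ->].
elim: s => [|x s IHs]; first by rewrite set_nil.
suff -> : [set` x :: s] = x |` [set` s] by exact: PU.
by apply/seteqP; split=> y; rewrite /= inE;
  [move=> /predU1P|move=> ys; apply/predU1P].
Qed.

(** The bridge between finite subfamilies of a family of traces or preimages and
finite subfamilies of the original family. *)
Lemma finite_set_preimage (S T : Type) (g : S -> T) (U : set S) (V : set T) :
  finite_set V -> V `<=` g @` U ->
  exists U', [/\ U' `<=` U, finite_set U' & g @` U' = V].
Proof.
move: V; apply: finite_set_induct => [_|x V IHV VU].
  by exists set0; rewrite image_set0; split.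
have [|U' [U'U finU' gU']] := IHV; first by move=> y Vy; apply: VU; right.
have [|u Uu gu] := VU x; first by left.
exists (u |` U'); split; first by move=> y [->|/U'U].
  by rewrite finite_setU; split.
by rewrite image_setU gU' image_set1 gu.
Qed.

Lemma finitely_covered_sub (M : Type) (A B : set M) (U : set (set M)) :
  A `<=` B -> finitely_covered B U -> finitely_covered A U.
Proof. by move=> AB [V [VU finV BV]]; exists V; split=> // x /AB/BV. Qed.

Lemma preimage_bigU (S T : Type) (f : S -> T) (U : set (set T)) :
  bigU [set f @^-1` V | V in U] = f @^-1` bigU U.
Proof.
by rewrite /bigU bigcup_image preimage_bigcup.
Qed.

Lemma bigU_trace (M : Type) (K : set M) (U : set (set M)) :
  bigU (trace K U) = K `&` bigU U.
Proof. by rewrite /bigU bigcup_image setI_bigcupr. Qed.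

Lemma bigU_setU1 (M : Type) (V : set M) (U : set (set M)) :
  bigU (V |` U) = V `|` bigU U.
Proof. by rewrite /bigU bigcup_setU1. Qed.

Lemma bigI_setU1 (M : Type) (V : set M) (U : set (set M)) :
  bigI (V |` U) = V `&` bigI U.
Proof. by rewrite /bigI bigcap_setU1. Qed.

(** Both directions matter: one makes preimages of admissible families
admissible, the other makes images of small sets small. *)
Lemma finitely_covered_preimage (S T : Type) (f : S -> T) (K : set S)
    (U : set (set T)) :
  finitely_covered (f @` K `&` bigU U) U <->
  finitely_covered (K `&` f @^-1` bigU U) [set f @^-1` V | V in U].
Proof.
split=> [[V [VU finV KV]]|[W [WU finW]]]; last first.
  have [V [VU finV <-]] := finite_set_preimage finW WU.
  rewrite preimage_bigU => KV; exists V; split=> // _ [[x Kx <-] Ux].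
  exact: KV.
exists [set f @^-1` W | W in V]; split.
- exact: image_subset.
- exact: finite_image.
- by rewrite preimage_bigU => x [Kx Ux]; apply: KV; split=> //; exists x.
Qed.

Lemma finitely_covered_trace (M : Type) (K : set M) (U : set (set M)) :
  finitely_covered (K `&` bigU U) (trace K U) <->
  finitely_covered (K `&` bigU U) U.
Proof.
split=> [[W [WU finW]]|[V [VU finV KV]]].
  have [V [VU finV <-]] := finite_set_preimage finW WU.
  by rewrite bigU_trace => KV; exists V; split=> // x /KV[].
exists (trace K V); split.
- exact: image_subset.
- exact: finite_image.
- by rewrite bigU_trace => x KUx; split; [case: KUx | exact: KV].
Qed.

(** * Opens and small sets of a generalized topological space *)

Section GtsOpens.
Variable X : gts.
Implicit Types U V K : set X.

Lemma gopen0 : gopen (set0 : set X).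
Proof.
by have [] := @gts_finiteness X set0 (finite_set0 _) (sub0set _);
  rewrite /bigU bigcup_set0.
Qed.

Lemma gopenT : gopen [set: X].
Proof.
by have [] := @gts_finiteness X set0 (finite_set0 _) (sub0set _);
  rewrite /bigI bigcap_set0.
Qed.

Lemma gopenU U V : gopen U -> gopen V -> gopen (U `|` V).
Proof.
move=> oU oV; have [|+ + _] := @gts_finiteness X [set U; V] (finite_set2 _ _).
  by move=> _ [->|->].
by rewrite /bigU /bigI bigcup_setU1 bigcup_set1.
Qed.

Lemma gopenI U V : gopen U -> gopen V -> gopen (U `&` V).
Proof.
move=> oU oV; have [|+ + _] := @gts_finiteness X [set U; V] (finite_set2 _ _).
  by move=> _ [->|->].
by rewrite /bigU /bigI bigcap_setU1 bigcap_set1.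
Qed.

Lemma gadm_set1 U : gopen U -> gadm [set U].
Proof.
by move=> oU; have [_ ->|] := @gts_finiteness X [set U] (finite_set1 _).
Qed.

Lemma gopen_setC_finite : strongly_T1 X ->
  forall F : set X, finite_set F -> gopen (~` F).
Proof.
move=> T1X; apply: finite_set_induct => [|x F oF].
  by rewrite setC0; exact: gopenT.
by rewrite setCU; apply: gopenI => //; exact: T1X.
Qed.

End GtsOpens.

Lemma gopen_preimage (X Y : gts) (f : X -> Y) (V : set Y) :
  strictly_continuous f -> gopen V -> gopen (f @^-1` V).
Proof.
move=> cf /gadm_set1/cf; rewrite image_set1 => /gadm_open; exact.
Qed.

Lemma small_image (X Y : gts) (f : X -> Y) (K : set X) :
  strictly_continuous f -> small K -> small (f @` K).
Proof.
move=> cf sK U /cf/sK; rewrite preimage_bigU.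
by move/finitely_covered_preimage.
Qed.

Lemma small_sub (X : gts) (K L : set X) : K `<=` L -> small L -> small K.
Proof.
by move=> KL sL U /sL; apply: finitely_covered_sub => x [/KL Lx]; split.
Qed.

(** The subspace structure is transitive, so that inclusion is the only relation
to be checked in (W2). *)
Lemma closed_small_subspace_sub (X : gts) (K L : set X) :
  K `<=` L -> gclosed K -> small K -> closed_small_subspace K L.
Proof.
move=> KL cK sK; split=> //.
- by exists (~` K).
- move=> _ [U admU <-].
  have fU := sK U admU; rewrite bigU_trace setIA (setIidl KL).
  have : finitely_covered (L `&` bigU U `&` K) (trace L U).
    have [V [VU finV KV]] := fU.
    exists (trace L V); split; [exact: image_subset|exact: finite_image|].
    by rewrite bigU_trace => x [[Lx Ux] Kx]; split=> //; apply: KV.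
  by apply: finitely_covered_sub => x [Kx Ux]; do !split => //; exact: KL.
- rewrite /sub_open /trace image_comp; apply: eq_imagel => V _ /=.
  by rewrite setIA (setIidl KL).
- rewrite /sub_adm image_comp; apply: eq_imagel => U _ /=.
  rewrite /trace image_comp; apply: eq_imagel => V _ /=.
  by rewrite setIA (setIidl KL).
Qed.

(** * Exhaustions *)

Section Exhaustion.
Variables (X : gts) (A : Type) (le : A -> A -> Prop) (E : A -> set X).
Hypothesis exhE : exhaustion le E.

Lemma exhaustion_gopen (U : set X) :
  (forall a, exists2 V, gopen V & E a `&` U = E a `&` V) -> gopen U.
Proof.
move=> oU; apply/(exh_W6_open exhE) => a.
by have [V oV ->] := oU a; exists V.
Qed.

(** (W6) asks for an admissible family of [X] with a given trace on [E a].  If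
[V] is a finite subfamily of [U] with the same union on [E a], the trace of
[U] on the open set [bigU V] is such a family: it contains [V], hence is
admissible by saturation, and on [E a] nothing is lost. *)
Lemma exhaustion_gadm (U : set (set X)) : U `<=` @gopen X ->
  (forall a, finitely_covered (E a `&` bigU U) U) -> gadm U.
Proof.
move=> oU fU; apply/(exh_W6_adm exhE oU) => a.
have [V [VU finV EV]] := fU a.
have [|oV _ admV] := @gts_finiteness X V finV; first exact: subset_trans oU.
exists (trace (bigU V) U).
  apply: gts_saturation admV _ _.
    by move=> _ [W /oU oW <-]; exact: gopenI.
  split.
    by rewrite bigU_trace; apply/seteqP; split=> [x [W VW Wx]|x []//];
      split; exists W => //; exact: VU.
  move=> W VW; exists (bigU V `&` W); first by exists W => //; exact: VU.
  by move=> x Wx; split=> //; exists W.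
rewrite /trace image_comp; apply: eq_imagel => W UW /=.
rewrite setIA; apply/seteqP; split=> x [] => [[]//|Ex Wx]; split=> //.
by split=> //; apply: EV; split=> //; exists W.
Qed.

Lemma exhaustion_finite_below a : finite_set [set b | le b a].
Proof.
apply: sub_finite_set (_ : _ `<=` a |` [set b | le b a /\ b <> a]) _.
  by move=> b ba; have [->|] := pselect (b = a); [left|right].
by rewrite finite_setU; split=> //; exact: (exh_W3 exhE).
Qed.

(** By (W4) the indices [b] with [E b x] are directed downwards, and by (W3)
those below one of them are finitely many, so that they have a common lower
bound. *)
Lemma exhaustion_least (x : X) :
  exists2 a, E a x & forall b, E b x -> le a b.
Proof.
have [le_refl _ le_trans] := exh_order exhE.
have [a _ Eax] : (\bigcup_a E a) x by rewrite (exh_W1 exhE).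
have lower D : finite_set D -> exists2 c, E c x /\ le c a &
    forall b, D b -> E b x -> le c b.
  move: D; apply: finite_set_induct => [|d D [c [Ecx ca] cD]].
    by exists a.
  have [Edx|nEdx] := pselect (E d x).
    have [e [ec ed Ee]] := exh_W4 exhE c d.
    exists e => [|b [->//|Db Ebx]]; first by rewrite -Ee; split; first by [];
      exact: le_trans ca.
    exact: le_trans (cD b _ _).
  by exists c => // b [->//|Db Ebx]; exact: cD.
have [c [Ecx _] cD] := lower _ (exhaustion_finite_below a).
exists c => // b Ebx; have [d [da db Ed]] := exh_W4 exhE a b.
by apply: (le_trans _ d) => //; apply: cD => //; rewrite -Ed.
Qed.

(** Let [m x] be the least index of a member containing [x].  If [m] takes
finitely many values on [L], the member at an upper bound of them (W5)
contains [L]. Otherwise choose a set [S] of points of [L], one for each value.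
A point of [S] in [E a] has its least index below [a], so [S] meets each [E a]
in a finite set; as points are closed, this makes all subsets of [S] closed
and the open sets [~` (S `\ x)], [x] in [S], an admissible cover of [X]. Each
of them contains a single point of [S], so finitely many do not cover [L]. *)
Lemma small_sub_exhaustion : strongly_T1 X ->
  forall L : set X, L !=set0 -> small L -> exists a, L `<=` E a.
Proof.
move=> T1X L [x0 Lx0] smL.
have [_ _ le_trans] := exh_order exhE.
have /choice[m mP] : forall x, exists a, E a x /\ forall b, E b x -> le a b.
  by move=> x; have [a] := exhaustion_least x; exists a.
suff finI : finite_set (m @` L).
  have [c cP] : exists c, forall a, (m @` L) a -> le a c.
    move: (m @` L) finI; apply: finite_set_induct => [|a D [c cP]].
      by exists (m x0).
    have [d [ad cd]] := exh_W5 exhE a c.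
    by exists d => b [->//|/cP bc]; exact: le_trans cd.
  exists c => x Lx; have [Emx _] := mP x.
  apply: (css_subset (exh_W2 exhE (cP (m x) _))) => //; by exists x.
have /choice[r rP] : forall a, exists x, (m @` L) a -> L x /\ m x = a.
  move=> a; have [[x Lx <-]|nLa] := pselect ((m @` L) a); first by exists x.
  by exists x0.
pose S := r @` (m @` L).
have SL x : S x -> L x by move=> [a /rP[Lr _] <-].
have finSE a : finite_set (E a `&` S).
  apply: (@sub_finite_set _ _ (r @` [set b | le b a])).
    move=> y [Ey [b bL ry]]; exists b => //; rewrite -ry in Ey.
    by have [_ <-] := rP b bL; have [_] := mP (r b); exact.
  by apply: finite_image; exact: exhaustion_finite_below.
pose O x := ~` (S `\ x).
have oO x : gopen (O x).
  apply: exhaustion_gopen => a; exists (~` (E a `&` S `\ x)).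
    by apply: gopen_setC_finite => //; apply: sub_finite_set (finSE a) => y [].
  apply/seteqP; split=> y [Ey Oy]; split=> // -[]; first by move=> [_ Sy] xy;
    apply: Oy.
  by move=> Sy xy; apply: Oy.
have Sr0 : S (r (m x0)) by exists (m x0) => //; exists x0.
have admO : gadm (O @` S).
  apply: exhaustion_gadm => [_ [x _ <-]//|a].
  exists (O @` (r (m x0) |` (E a `&` S))); split.
  - by apply: image_subset => y [->|[]].
  - by apply: finite_image; rewrite finite_setU; split.
  - move=> x [Ex _]; have [Sx|nSx] := pselect (S x).
      by exists (O x); [exists x => //; right | case=> _; apply].
    by exists (O (r (m x0))); [exists (r (m x0)) => //; left | case].
have [V [VO finV LV]] := smL _ admO.
have finS : finite_set S.
  apply: (@sub_finite_set _ _ (\bigcup_(W in V) (S `&` W))).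
    move=> x Sx; have [|W VW Wx] := LV x; last by exists W.
    split; first exact: SL.
    by exists (O x); [exists x | case=> _; apply].
  apply: bigcup_finite => // _ /VO[x Sx <-].
  apply: sub_finite_set (finite_set1 x) => y [Sy Oy].
  by apply: contrapT => yx; apply: Oy.
apply: sub_finite_set (finite_image m finS) => a aL.
by exists (r a); [exists a | case: (rP a aL)].
Qed.

End Exhaustion.

(** * The inductive limit structure *)

(** An inductive closure instead of finite unions of finite intersections, so
that inverse images of its members are handled by induction. *)
Inductive lattice_gen (T : Type) (G : set (set T)) : set (set T) :=
| lattice_gen_sub U : G U -> lattice_gen G U
| lattice_gen0 : lattice_gen G set0
| lattice_genT : lattice_gen G setT
| lattice_genU U V : lattice_gen G U -> lattice_gen G V ->
    lattice_gen G (U `|` V)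
| lattice_genI U V : lattice_gen G U -> lattice_gen G V ->
    lattice_gen G (U `&` V).

Lemma lattice_gen_bigcup (T : Type) (G : set (set T)) (I : Type)
    (F : I -> set T) : finite_set [set: I] ->
  (forall i, lattice_gen G (F i)) -> lattice_gen G (\bigcup_i F i).
Proof.
move=> + GF; move: setT.
apply: finite_set_induct => [|i D GD].
  by rewrite bigcup_set0; exact: lattice_gen0.
by rewrite bigcup_setU1; exact: lattice_genU.
Qed.

Section InductiveLimit.
Variables (T A : Type) (E : A -> set T) (G : set (set T)).

Definition ind_open : set (set T) :=
  [set U | forall a, exists2 W, lattice_gen G W & E a `&` U = E a `&` W].

Definition ind_adm : set (set (set T)) :=
  [set U | U `<=` ind_open /\
     forall a, finitely_covered (E a `&` bigU U) U].

Lemma ind_open_gen U : lattice_gen G U -> ind_open U.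
Proof. by move=> GU a; exists U. Qed.

Lemma ind_openU U V : ind_open U -> ind_open V -> ind_open (U `|` V).
Proof.
move=> oU oV a; have [W GW UW] := oU a; have [W' GW' VW] := oV a.
by exists (W `|` W'); [exact: lattice_genU | rewrite !setIUr UW VW].
Qed.

Lemma ind_openI U V : ind_open U -> ind_open V -> ind_open (U `&` V).
Proof.
move=> oU oV a; have [W GW UW] := oU a; have [W' GW' VW] := oV a.
exists (W `&` W'); first exact: lattice_genI.
by rewrite setIIr [RHS]setIIr UW VW.
Qed.

Lemma ind_open_bigU U : finite_set U -> U `<=` ind_open -> ind_open (bigU U).
Proof.
move: U; apply: finite_set_induct => [_|V U IHU VU].
  by rewrite /bigU bigcup_set0; apply: ind_open_gen; exact: lattice_gen0.
rewrite bigU_setU1; apply: ind_openU; first by apply: VU; left.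
by apply: IHU => W UW; apply: VU; right.
Qed.

Lemma ind_open_bigI U : finite_set U -> U `<=` ind_open -> ind_open (bigI U).
Proof.
move: U; apply: finite_set_induct => [_|V U IHU VU].
  by rewrite /bigI bigcap_set0; apply: ind_open_gen; exact: lattice_genT.
rewrite bigI_setU1; apply: ind_openI; first by apply: VU; left.
by apply: IHU => W UW; apply: VU; right.
Qed.

Lemma ind_finiteness U : finite_set U -> U `<=` ind_open ->
  [/\ ind_open (bigU U), ind_open (bigI U) & ind_adm U].
Proof.
move=> finU oU; split; [exact: ind_open_bigU|exact: ind_open_bigI|].
by split=> // a; exists U; split=> // x [].
Qed.

Lemma ind_stability V U : ind_open V -> ind_adm U -> ind_adm (trace V U).
Proof.
move=> oV [oU fU]; split=> [_ [W UW <-]|a]; first exact: ind_openI oV (oU _ UW).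
have [U' [U'U finU' EU']] := fU a.
exists (trace V U'); split; [exact: image_subset|exact: finite_image|].
by rewrite !bigU_trace => x [Ex [Vx Ux]]; split=> //; apply: EU'.
Qed.

Lemma ind_transitivity (Phi : set (set (set T))) : Phi `<=` ind_adm ->
  ind_adm [set bigU U | U in Phi] -> ind_adm (\bigcup_(U in Phi) U).
Proof.
move=> admPhi [_ fPhi]; split=> [V [U /admPhi[oU _] UV]|a]; first exact: oU.
have [W [WPhi finW EW]] := fPhi a.
have [Psi [PsiPhi finPsi Psi_eq]] := finite_set_preimage finW WPhi.
have /choice[r rP] : forall U, exists V, Phi U ->
    [/\ V `<=` U, finite_set V & E a `&` bigU U `<=` bigU V].
  move=> U; have [/admPhi[_ /(_ a)[V]]|nU] := pselect (Phi U); first by exists V.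
  by exists set0.
exists (\bigcup_(U in Psi) r U); split.
- move=> V [U /PsiPhi PhiU rV]; exists U => //.
  by have [rU _ _] := rP U PhiU; exact: rU.
- by apply: bigcup_finite => // U /PsiPhi /rP[].
- move=> x [Ex [V [U PhiU UV] Vx]].
  have [|O] := EW x; first split=> //.
    by exists (bigU U); [exists U | exists V].
  rewrite -Psi_eq => -[U' PsiU' U'_eq]; rewrite -U'_eq => U'x.
  have [_ _ /(_ x)[//|V' rV' V'x]] := rP U' (PsiPhi _ PsiU').
  by exists V' => //; exists U'.
Qed.

Lemma ind_saturation (U V : set (set T)) :
  ind_adm U -> V `<=` ind_open -> refines U V -> ind_adm V.
Proof.
move=> [_ fU] oV [UV_eq UV]; split=> // a.
have [U' [U'U finU' EU']] := fU a.
have /choice[r rP] : forall W, exists W', U W -> V W' /\ W `<=` W'.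
  move=> W; have [/UV[W']|nW] := pselect (U W); first by exists W'.
  by exists W.
exists (r @` U'); split; [|exact: finite_image|].
  by move=> _ [W /U'U/rP[rW _] <-].
rewrite -UV_eq => x /EU'[W U'W Wx]; exists (r W); first by exists W.
by have [_] := rP W (U'U _ U'W); apply.
Qed.

(** Given [a], the union of [U] may be replaced by a finite union, for which the
traces of [W] add up to an open set. *)
Lemma ind_regularity W U :
  ind_adm U -> trace W U `<=` ind_open -> ind_open (W `&` bigU U).
Proof.
move=> [_ fU] oWU a; have [V [VU finV EV]] := fU a.
have [|W' GW' WW'] := ind_open_bigU (finite_image (setI W) finV) _ a.
  by apply: subset_trans oWU; exact: image_subset.
exists W' => //; rewrite -WW' bigU_trace; apply/seteqP.
split=> x [Ex [Wx [O UO Ox]]]; do !split=> //; last by exists O => //; exact: VU.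
by apply: EV; split=> //; exists O.
Qed.

Definition ind_gts : gts :=
  Gts (fun U (admU : ind_adm U) => admU.1) ind_finiteness ind_stability
    ind_transitivity ind_saturation ind_regularity.

Lemma ind_exhaustion (le : A -> A -> Prop) :
  partial_order le ->
  (forall a, lattice_gen G (~` E a)) ->
  \bigcup_a E a = setT ->
  (forall a b, le a b -> E a `<=` E b) ->
  (forall a, finite_set [set b | le b a /\ b <> a]) ->
  (forall a b, exists c, [/\ le c a, le c b & E a `&` E b = E c]) ->
  (forall a b, exists c, le a c /\ le b c) ->
  exhaustion (X := ind_gts) le E.
Proof.
move=> le_order clE W1 mono W3 W4 W5.
have clE' a : gclosed (X := ind_gts) (E a) by exact: ind_open_gen.
have smE a : small (X := ind_gts) (E a) by move=> U [_]; exact.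
split=> // [a b /mono ab|U|U oU].
- exact: closed_small_subspace_sub.
- split=> [oU a|oU a]; first by exists U.
  by have [V oV <-] := oU a; exact: oV.
- split=> [admU a|admU]; first by exists U.
  split=> // a; have [U' [oU' fU'] UU'] := admU a.
  apply/finitely_covered_trace; rewrite -UU' -bigU_trace -UU' bigU_trace.
  exact/finitely_covered_trace.
Qed.

Lemma ind_strictly_continuous_from (Y : gts) (p : T -> Y) :
  (forall V, gopen V -> lattice_gen G (p @^-1` V)) ->
  (forall a, small (p @` E a)) ->
  strictly_continuous (X := ind_gts) p.
Proof.
move=> Gp smp U admU; split=> [_ [V /(gadm_open admU) oV <-]|a].
  by apply: ind_open_gen; exact: Gp.
by rewrite preimage_bigU; apply/finitely_covered_preimage; exact: smp.
Qed.

(** Only the case of a nonempty [K] is asked for, because an empty set lies in no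
member when the index set [A] is empty. *)
Lemma ind_strictly_continuous_to (Y : gts) (h : Y -> T) : weakly_small Y ->
  (forall V, G V -> gopen (h @^-1` V)) ->
  (forall K : set Y, K !=set0 -> small K -> exists a, h @` K `<=` E a) ->
  strictly_continuous (Y := ind_gts) h.
Proof.
move=> [C [le [H exhH]]] oh hE.
have oGh W : lattice_gen G W -> gopen (h @^-1` W).
  elim=> {W} [W /oh//|||U V _ oU _ oV|U V _ oU _ oV].
  - exact: gopen0.
  - exact: gopenT.
  - exact: gopenU.
  - exact: gopenI.
have oIh U : ind_open U -> gopen (h @^-1` U).
  move=> oU; apply: (exhaustion_gopen exhH) => c.
  have [H0|/set0P Hn0] := eqVneq (H c) set0.
    by exists set0; [exact: gopen0 | rewrite H0 !set0I].
  have [a hEa] := hE _ Hn0 (exh_small exhH c); have [W GW UW] := oU a.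
  exists (h @^-1` W); first exact: oGh.
  apply/seteqP; split=> y [Hy Uy]; split=> //.
    by have [] : (E a `&` W) (h y) by rewrite -UW; split=> //; apply: hEa; exists y.
  by have [] : (E a `&` U) (h y) by rewrite UW; split=> //; apply: hEa; exists y.
move=> U [oU fU]; apply: (exhaustion_gadm exhH) => [_ [V /oU oV <-]|c].
  exact: oIh.
rewrite preimage_bigU; apply/finitely_covered_preimage.
have [H0|/set0P Hn0] := eqVneq (H c) set0.
  by exists set0; split=> //; rewrite H0 image_set0 => x [].
have [a hEa] := hE _ Hn0 (exh_small exhH c).
by apply: finitely_covered_sub (fU a) => x [/hEa Ex]; split.
Qed.

End InductiveLimit.

(** * Finite products of index sets *)

(** Induction on a list [s] of indices: only finitely many families agree with a
fixed family [a] outside [s] and take values in [D] on [s]. *)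
Lemma finite_set_forall (I : eqType) (A : I -> Type) (D : forall i, set (A i)) :
  finite_set [set: I] ->
  (forall i, finite_set (D i)) -> finite_set [set b | forall i, D i (b i)].
Proof.
move=> /finite_seqP[r rT] finD.
have [[a _]|nD] := pselect (exists a : forall i, A i, True); last first.
  by apply: sub_finite_set (finite_set0 _) => b _; apply: nD; exists b.
have finS (s : seq I) : finite_set
    [set b | forall i, (i \in s -> D i (b i)) /\ (i \notin s -> b i = a i)].
  elim: s => [|i s IHs].
    apply: sub_finite_set (finite_set1 a) => b bP.
    by apply: functional_extensionality_dep => i; have [_ ->] := bP i.
  apply: sub_finite_set
    (finite_image2 (fun b (x : A i) => dfwith b x) IHs (finD i)) => b bP.
  have [si|nsi] := boolP (i \in s).
    exists b; [move=> j|exists (b i); last first].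
    - have [bD bs] := bP j; split=> js; first by apply: bD; rewrite inE js orbT.
      by apply: bs; rewrite inE negb_or js andbT; apply: contraNneq js => ->.
    - by apply: functional_extensionality_dep => j; case: dfwithP.
    - by have [+ _] := bP i; apply; rewrite inE eqxx.
  exists (dfwith b (a i)); [move=> j|exists (b i); last first].
  - case: dfwithP => [|j' ij]; first by split=> //; rewrite (negbTE nsi).
    have [bD bs] := bP j'; split=> js; first by apply: bD; rewrite inE js orbT.
    by apply: bs; rewrite inE negb_or js andbT eq_sym.
  - apply: functional_extensionality_dep => j.
    by case: dfwithP => // j' ij; rewrite dfwith_out.
  - by have [+ _] := bP i; apply; rewrite inE eqxx.
apply: sub_finite_set (finS r) => b bD i.
by have -> : i \in r by [have : [set: I] i by []; rewrite rT]; split.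
Qed.

(** * Initial structures on subsets of finite products *)

(** The index type is in [Set] for the sake of universes: a product over a larger
type of spaces would be too large to carry a [gts]. *)
Lemma initial_structure (I : Set) (X : I -> gts)
    (P : set (forall i, X i)) : finite_set [set: I] ->
  (forall i, weakly_small (X i)) -> (forall i, strongly_T1 (X i)) ->
  exists (Z : gts) (pr : Z -> forall i, X i),
    [/\ weakly_small Z /\ strongly_T1 Z,
        injective pr, range pr = P,
        forall i, strictly_continuous (fun z => pr z i) &
        forall (Y : gts) (h : Y -> Z), weakly_small Y ->
          (forall i, strictly_continuous (fun y => pr (h y) i)) ->
          strictly_continuous h].
Proof.
move=> finI wsX T1X.
have data i : {A : Type & {le : A -> A -> Prop & {E : A -> set (X i) |
    exhaustion le E}}}.
  by have /cid[A /cid[le /cid[E exhE]]] := wsX i; exists A, le, E.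
pose A i := projT1 (data i).
pose le i : A i -> A i -> Prop := projT1 (projT2 (data i)).
pose E i : A i -> set (X i) := sval (projT2 (projT2 (data i))).
have exhE i : exhaustion (@le i) (@E i) by exact: svalP (projT2 (projT2 (data i))).
pose T := {x : forall i, X i | P x}.
pose pr (x : T) := sval x.
pose leP (a b : forall i, A i) := forall i, le i (a i) (b i).
pose EP (a : forall i, A i) : set T := [set x | forall i, E i (a i) (pr x i)].
pose G : set (set T) :=
  [set V | exists i (U : set (X i)), gopen U /\ V = (fun x => pr x i) @^-1` U].
have Gpr i U : gopen U -> lattice_gen G ((fun x => pr x i) @^-1` U).
  by move=> oU; apply: lattice_gen_sub; exists i, U.
have prI : injective pr by move=> x y; exact: eq_sig_hprop.
have setC_forall (D : forall i, set (X i)) :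
    ~` [set x : T | forall i, D i (pr x i)] =
    \bigcup_i (fun x => pr x i) @^-1` (~` D i).
  apply/seteqP; split=> [x /existsNP[i nDi]|x [i _ nDi] /(_ i)//].
  by exists i.
exists (ind_gts EP G), pr; split=> //.
- split.
    exists (forall i, A i), leP, EP; apply: ind_exhaustion.
    + split=> [a i|a b ab ba|a b c ab bc i].
      * exact: (po_refl (exh_order (exhE i))).
      * apply: functional_extensionality_dep => i.
        exact: (po_anti (exh_order (exhE i))).
      * exact: (po_trans (exh_order (exhE i))) (ab i) (bc i).
    + move=> a; rewrite (setC_forall (fun i => E i (a i))).
      apply: lattice_gen_bigcup => // i.
      by apply: Gpr; exact: (exh_closed (exhE i)).
    + apply/seteqP; split=> // x _.
      have cov i : {a | E i a (pr x i)}.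
        apply: cid; have : (\bigcup_a E i a) (pr x i) by rewrite (exh_W1 (exhE i)).
        by case=> a _; exists a.
      by exists (fun i => sval (cov i)) => // i; exact: svalP (cov i).
    + by move=> a b ab x Ex i; exact: (css_subset (exh_W2 (exhE i) (ab i))).
    + move=> a; apply: (@sub_finite_set _ _
        [set b | forall i, le i (b i) (a i)]); first by move=> b [].
      apply: (@finite_set_forall {classic I} A
        (fun i => [set c | le i c (a i)])) => // i.
      exact: exhaustion_finite_below (exhE i) (a i).
    + move=> a b.
      have /all_sig[c cP] i : {c | [/\ le i c (a i), le i c (b i) &
          E i (a i) `&` E i (b i) = E i c]} by apply/cid/(exh_W4 (exhE i)).
      exists c; split=> [i|i|]; [by case: (cP i)..|].
      apply/seteqP; split=> x; first by move=> [Ea Eb] i; have [_ _ <-] := cP i.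
      by move=> Ec; split=> i; have := Ec i; have [_ _ <-] := cP i; case.
    + move=> a b.
      have /all_sig[c cP] i : {c | le i (a i) c /\ le i (b i) c}
        by apply/cid/(exh_W5 (exhE i)).
      by exists c; split=> i; case: (cP i).
  move=> x; rewrite /gclosed.
  have -> : [set x] = [set y : T | forall i, [set pr x i] (pr y i)].
    apply/seteqP; split=> [_ ->//|y xy]; apply: prI.
    by apply: functional_extensionality_dep => i; exact: xy.
  rewrite (setC_forall (fun i => [set pr x i])); apply: ind_open_gen.
  apply: lattice_gen_bigcup => // i.
  by apply: Gpr; exact: T1X.
- by apply/seteqP; split=> [_ [x _ <-]|x Px]; [exact: svalP | exists (exist _ x Px)].
- move=> i; apply: ind_strictly_continuous_from => [V|a]; first exact: Gpr.
  by apply: small_sub (exh_small (exhE i) (a i)) => _ [x Ex <-]; exact: Ex.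
- move=> Y h wsY ch; apply: ind_strictly_continuous_to => //.
    by move=> _ [i [U [oU ->]]]; exact: gopen_preimage (ch i) oU.
  move=> K [y Ky] smK.
  have /all_sig[a aP] i : {a | (fun y => pr (h y) i) @` K `<=` E i a}.
    apply: cid; apply: (small_sub_exhaustion (exhE i) (T1X i)).
      by exists (pr (h y) i); exists y.
    exact: small_image.
  by exists a => _ [z Kz <-] i; apply: aP; exists z.
Qed.

(** * Finite limits *)

Theorem theorem5p6 : finitely_complete WSS1.
Proof.
move=> J [/(@finite_seqP {classic J})[s sJ] _] F.
(* The objects of [J] live in a universe too large for [gts]: index by [I]. *)
pose I : Set := {k : nat | k < size s}.
pose ord_I (k : 'I_(size s)) : I := exist _ (val k) (ltn_ord k).
have finI : finite_set [set: I].
  suff -> : [set: I] = range ord_I by exact/finite_image/finite_finset.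
  by apply/seteqP; split=> // -[k ks] _; exists (Ordinal ks) => //; exact: eq_exist.
pose e (k : I) : J := tnth (in_tuple s) (Ordinal (svalP k)).
have e_surj (j : J) : exists k, e k = j.
  have /tnthP[k ->] : (j : {classic J}) \in in_tuple s; last first.
    by exists (ord_I k); congr tnth; exact: val_inj.
  by have : [set` s] j by rewrite -sJ.
pose natural (y : forall j : J, sval (F j)) :=
  forall i j (u : hom i j), sval (fhom F u) (y i) = y j.
(* The enumeration [e] may repeat objects.  Asking for a natural family [y] over
   all of [J], which then determines the tuple, avoids transporting along
   equalities of objects. *)
pose P : set (forall k, sval (F (e k))) :=
  [set x | exists y, natural y /\ forall k, x k = y (e k)].
have [Z [pr [wsT1Z prI prP pr_cont Z_univ]]] := initial_structure P finI
  (fun k => (svalP (F (e k))).1) (fun k => (svalP (F (e k))).2).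
have /all_sig[y yP] z : {y | natural y /\ forall k, pr z k = y (e k)}.
  by apply: cid; have : P (pr z) by rewrite -prP; exists z.
have y_cont j : strictly_continuous (fun z => y z j).
  have [k <-] := e_surj j; have := pr_cont k; congr strictly_continuous.
  by apply: funext => z; have [_] := yP z.
pose L : WSS1 := exist _ Z wsT1Z.
pose legL j : hom L (F j) := exist _ (fun z => y z j) (y_cont j).
have legL_nat i j (u : hom i j) : cmp (fhom F u) (legL i) = legL j.
  by apply: gts_hom_eq; apply: funext => z; have [+ _] := yP z; apply.
exists (Cone legL_nat) => K.
have KP w : P (fun k => sval (leg K (e k)) w).
  by exists (fun j => sval (leg K j) w); split=> // i j u; rewrite -(leg_nat K u).
have /all_sig[h hP] w : {z | pr z = fun k => sval (leg K (e k)) w}.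
  by apply: cid; have := KP w; rewrite -prP => -[z _]; exists z.
have h_cont : strictly_continuous (h : sval (apex K) -> Z).
  apply: Z_univ => [|k]; first exact: (svalP (apex K)).1.
  by have := svalP (leg K (e k)); congr strictly_continuous;
    apply: funext => w; rewrite hP.
have yE z k : y z (e k) = pr z k by have [_] := yP z.
exists (exist _ h h_cont); split=> [j|h' h'P].
  apply: gts_hom_eq; apply: funext => w /=.
  by have [k <-] := e_surj j; rewrite yE hP.
apply: gts_hom_eq; apply: funext => w /=; apply: prI; rewrite hP.
apply: functional_extensionality_dep => k.
by rewrite -(h'P (e k)) /= yE.
Qed.
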